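(* The set of all possible cardinalities $|A^*|$, where $A$ ranges over all reduced rings with finite group of units, has density zero.
   Context: Rings are commutative with $1\neq 0$; a ring is reduced if its only nilpotent element is $0$. $A^*$ denotes the multiplicative group of invertible elements of $A$. For $X\subset\mathbb{N}$ and $n\in\mathbb N$ put $X(n):=X\cap\{1,\dots,n\}$; the density of $X$ is $\lim_{n\to\infty}\frac{|X(n)|}{n}$, whenever this limit exists (the claim includes its existence). *)

(* Defs.v *)
From HB Require Import structures.
From mathcomp Require Import all_boot all_order all_algebra finmap.
From mathcomp Require Import all_classical all_reals all_analysis.

Set Implicit Arguments.
Unset Strict Implicit.
Unset Printing Implicit Defensive.

Import Order.TTheory GRing.Theory Num.Theory.
Import numFieldNormedType.Exports.

Local Open Scope classical_set_scope.
Local Open Scope ring_scope.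

Definition reduced_ring (A : comUnitRingType) : Prop :=
  forall (x : A) (n : nat), x ^+ n = 0 -> x = 0.

(* Classically, every nonzero commutative ring carries a comUnitRingType
   structure, whose predicate GRing.unit is exactly invertibility. *)
Definition units (A : comUnitRingType) : set A :=
  [set x : A | x \is a GRing.unit].

Arguments units : clear implicits.

Definition reduced_unit_cards : set nat :=
  [set n : nat | exists A : comUnitRingType,
     [/\ reduced_ring A, finite_set (units A)
       & #|` fset_set (units A)| = n]].

Definition initial_part (X : set nat) (n : nat) : set nat :=
  X `&` [set k : nat | (1 <= k <= n)%N].

(* The term at n = 0 is 0 / 0 = 0 and does not affect the limit. *)
Definition has_density (R : realType) (X : set nat) (d : R) : Prop :=
  (#|` fset_set (initial_part X n)|%:R / n%:R : R) @[n --> \oo] --> d.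

(* Main.v *)
Require Import Defs.
From HB Require Import structures.
From mathcomp Require Import all_boot all_order all_algebra.
From mathcomp Require Import all_fingroup all_solvable all_field.
From mathcomp Require Import all_classical all_reals all_analysis.
From mathcomp Require Import zify ring lra.

Set Implicit Arguments.
Unset Strict Implicit.
Unset Printing Implicit Defensive.

Import Order.TTheory GRing.Theory Num.Theory.

(** The unit group of a reduced ring A, when finite, has order a product of
    numbers q - 1 with q a prime power, and such products are rare because
    prime powers are.

    Algebra.  Let U be the unit group, and H the subgroup of the u such that
    u - 1 is additively torsion.  If p > 3 is prime and u ^ p lies in H, then u
    lies in H: otherwise the Bass cyclic unit attached to a suitable power of u
    would act on a nontorsion element as (1 + zeta) ^ k with zeta a primitive
    p-th root of unity, and 1 + zeta is off the unit circle, so this unit would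
    have infinite order (torsion_descent).  Hence the index of H has no prime
    factor above 3, and it is a product of factors 2 = 3 - 1 and 3 = 4 - 1.
    On the other side, the elements u - 1 with u in H span a finite subring I
    without unit (finite_subring_span), and H = {1 + x : x in I, 1 + x a unit}.
    As A is reduced, splitting I along idempotents gives a product of finite
    fields F_q, and each contributes the factor q - 1
    (count_qreg_shifted_product).

    Counting.  Let n be a product of numbers q - 1.  Each odd q contributes an
    even factor, so if 2 ^ k does not divide n there are fewer than k of those, and
    the other factors are Mersenne numbers 2 ^ m - 1.  A Chebyshev estimate
    bounds the number of primes in a dyadic block, proper prime powers and
    Mersenne products are much sparser, and a bound of order
    2 ^ j (log j) ^ e / j for the number of elements in [2 ^ j, 2 ^ (j + 1))
    survives products (thin_mul).  So for each k these n
    have density zero, while the multiples of 2 ^ k have density 2 ^ - k; let k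
    grow (shifted_product_count_small). *)

(** * Sets with few elements in dyadic blocks *)

Definition dyadic (P : pred nat) (j : nat) : nat :=
  count P (iota (2 ^ j) (2 ^ j)).

(** The block [2 ^ j, 2 ^ (j + 1)) contains O(2 ^ j (log j) ^ e / j) elements of P.
    The logarithm enters through the bound j < 2 ^ k, which keeps the estimate
    in nat and makes it directly summable over the j below 2 ^ k. *)
Definition thin (P : pred nat) : Prop :=
  exists C e, forall k j, j < 2 ^ k ->
    j.+1 * dyadic P j <= C * 2 ^ j * k.+1 ^ e.

Definition mulpred (P Q : pred nat) : pred nat :=
  fun n => `[< exists d e, [/\ P d, Q e & n = d * e] >].

Lemma mem_dyadic j n : (n \in iota (2 ^ j) (2 ^ j)) = (2 ^ j <= n < 2 ^ j.+1).
Proof. by rewrite mem_iota addnn -mul2n expnS. Qed.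

Lemma dyadic_bound (P : pred nat) j (s : seq nat) :
  (forall n, P n -> 2 ^ j <= n < 2 ^ j.+1 -> n \in s) -> dyadic P j <= size s.
Proof.
move=> Ps; rewrite /dyadic -size_filter; apply: uniq_leq_size.
  by rewrite filter_uniq ?iota_uniq.
by move=> n; rewrite mem_filter mem_dyadic => /andP[Pn jn]; apply: Ps.
Qed.

(** If n = x * y lies in block N, and x and y in blocks i and j, then i + j is
    N or N - 1. *)
Lemma dyadic_mul (P Q : pred nat) N :
  dyadic (mulpred P Q) N <=
    \sum_(i < N.+1) dyadic P i * (dyadic Q (N - i) + dyadic Q (N - i).-1).
Proof.
pose F R j := [seq n <- iota (2 ^ j) (2 ^ j) | (R : pred nat) n].
pose L i := [seq x * y | x <- F P i, y <- F Q (N - i) ++ F Q (N - i).-1].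
apply: leq_trans (dyadic_bound (s := flatten [seq L i | i <- iota 0 N.+1]) _) _.
  move=> n /asboolP[d [e [Pd Qe ->]]] /andP[le_de lt_de].
  have [d0 e0] : 0 < d /\ 0 < e.
    by apply/andP; rewrite -muln_gt0 (leq_trans _ le_de) ?expn_gt0.
  have /andP[led ltd] := trunc_log_bounds (erefl (1 < 2)) d0.
  have /andP[lee lte] := trunc_log_bounds (erefl (1 < 2)) e0.
  set i := trunc_log 2 d in led ltd; set j := trunc_log 2 e in lee lte.
  have ijN : i + j <= N.
    rewrite -ltnS -(ltn_exp2l _ _ (erefl (1 < 2))) expnD.
    exact: leq_ltn_trans (leq_mul led lee) lt_de.
  have Nij : N < i.+1 + j.+1.
    rewrite -(ltn_exp2l _ _ (erefl (1 < 2))) expnD.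
    exact: leq_ltn_trans le_de (ltn_mul ltd lte).
  apply/flatten_mapP; exists i; first by rewrite mem_iota; lia.
  apply: allpairs_f; first by rewrite mem_filter Pd mem_dyadic led.
  rewrite mem_cat !mem_filter Qe !mem_dyadic /=.
  have [-> | ->] : N - i = j \/ N - i = j.+1 by lia.
    by rewrite lee lte.
  by rewrite /= lee lte orbT.
rewrite size_flatten /shape -map_comp sumnE big_map -[iota _ _]/(index_iota 0 N.+1).
rewrite big_mkord leq_sum // => i _ /=.
by rewrite size_allpairs size_cat !size_filter.
Qed.

Lemma harmonic_le k n : n <= 2 ^ k ->
  (\sum_(i < n) (i.+1%:R^-1 : rat) <= k.+1%:R)%R.
Proof.
have pos i : (0 <= (i.+1%:R^-1 : rat))%R by rewrite invr_ge0 ler0n.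
have mono m n' : m <= n' ->
    (\sum_(i < m) (i.+1%:R^-1 : rat) <= \sum_(i < n') i.+1%:R^-1)%R.
  move=> /subnKC <-; rewrite big_split_ord /= lerDl.
  by apply: sumr_ge0 => i _; apply: pos.
move=> /mono /le_trans; apply; elim: k {n} => [|k IHk].
  by rewrite expn0 big_ord1.
rewrite expnS mul2n -addnn big_split_ord /= -[k.+2]addn1 natrD.
apply: lerD => //.
apply: (@le_trans _ _ (\sum_(i < 2 ^ k) ((2 ^ k)%:R^-1 : rat))%R).
  apply: ler_sum => i _; rewrite lef_pV2 ?posrE ?ltr0n ?expn_gt0 //.
  by rewrite ler_nat; lia.
by rewrite sumr_const card_ord -(mulr_natl (_^-1)%R) divff // pnatr_eq0 -lt0n expn_gt0.
Qed.

(** Since N + 1 <= (i + 1) + (j + 1) when i + j is N or N - 1, the product of the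
    weights 1 / (i + 1) and 1 / (j + 1) is at most
    (1 / (i + 1) + 1 / (j + 1)) / (N + 1), and summing over i costs one harmonic
    sum, that is one extra factor k + 1. *)
Lemma thin_mul (P Q : pred nat) : thin P -> thin Q -> thin (mulpred P Q).
Proof.
move=> [C [e HP]] [C' [e' HQ]].
(* The three harmonic sums H1, H2, H3 below are at most K, K and 2 K, and the
   first one occurs twice. *)
exists (5 * (C * C')), (e + e').+1 => k N ltN.
rewrite -(@ler_nat rat).
pose K : rat := (k.+1%:R)%R.
pose A : rat := (C%:R * K ^+ e)%R.
pose B : rat := (C'%:R * K ^+ e')%R.
pose h (i : nat) : rat := ((i.+1)%:R^-1)%R.
have K1 : (1 <= K)%R by rewrite /K ler1n.
have K0 : (0 <= K)%R by apply: le_trans K1.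
have A0 : (0 <= A)%R by rewrite mulr_ge0 ?exprn_ge0 ?ler0n.
have B0 : (0 <= B)%R by rewrite mulr_ge0 ?exprn_ge0 ?ler0n.
have h0 i : (0 <= h i)%R by rewrite invr_ge0 ler0n.
have hP j : j < 2 ^ k -> ((dyadic P j)%:R <= A * 2 ^+ j * h j :> rat)%R.
  move=> /HP; rewrite -(@ler_nat rat) => le_j.
  rewrite /h ler_pdivlMr ?ltr0n // mulrC -natrM (le_trans le_j) //.
  by rewrite !natrM !natrX /A mulrAC.
have hQ j : j < 2 ^ k -> ((dyadic Q j)%:R <= B * 2 ^+ j * h j :> rat)%R.
  move=> /HQ; rewrite -(@ler_nat rat) => le_j.
  rewrite /h ler_pdivlMr ?ltr0n // mulrC -natrM (le_trans le_j) //.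
  by rewrite !natrM !natrX /B mulrAC.
have H1 : (\sum_(i < N.+1) h i <= K)%R by apply: harmonic_le.
have H2 : (\sum_(i < N.+1) h (N - i)%N <= K)%R.
  rewrite (reindex_inj rev_ord_inj) /=; apply: le_trans H1.
  apply: ler_sum => i _; have ltiN := ltn_ord i.
  by rewrite (_ : (N - _) = i) //=; lia.
have H3 : (\sum_(i < N.+1) h (N - i)%N.-1 <= 2 * K)%R.
  rewrite big_ord_recr /= subnn /= addrC.
  rewrite (_ : 2 * K = K + K)%R; last by ring.
  apply: lerD; first by rewrite /h invr1.
  rewrite (reindex_inj rev_ord_inj) /=.
  apply: le_trans (_ : \sum_(i < N) h i <= _)%R; last first.
    by apply: harmonic_le; apply: ltnW.
  apply: ler_sum => i _; have ltiN := ltn_ord i.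
  by rewrite (_ : (N - _).-1 = i) //=; lia.
have key i : i <= N ->
    (N.+1%:R * (dyadic P i * (dyadic Q (N - i) + dyadic Q (N - i).-1))%N%:R <=
     A * B * 2 ^+ N * (2 * h i + h (N - i)%N + h (N - i)%N.-1))%R.
  move=> leiN.
  have li : i < 2 ^ k by apply: leq_ltn_trans ltN.
  have lj : N - i < 2 ^ k by apply: leq_ltn_trans ltN; apply: leq_subr.
  have lj' : (N - i).-1 < 2 ^ k by apply: leq_ltn_trans lj; apply: leq_pred.
  have le2 j : (i + j <= N)%N -> (N <= (i + j).+1)%N -> j < 2 ^ k ->
      (N.+1%:R * ((dyadic P i)%:R * (dyadic Q j)%:R) <=
       A * B * 2 ^+ N * (h i + h j) :> rat)%R.
    move=> leij leN ltj.
    have pi : (0 <= (dyadic P i)%:R :> rat)%R by rewrite ler0n.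
    have qj : (0 <= (dyadic Q j)%:R :> rat)%R by rewrite ler0n.
    have := ler_pM pi qj (hP _ li) (hQ _ ltj).
    have N0 : (0 <= N.+1%:R :> rat)%R by rewrite ler0n.
    move=> /(ler_wpM2l N0) /le_trans; apply.
    have -> : (N.+1%:R * (A * 2 ^+ i * h i * (B * 2 ^+ j * h j)) =
              A * B * (2 ^+ (i + j) * (N.+1%:R * (h i * h j))))%R.
      by rewrite exprD; ring.
    rewrite -[leRHS]mulrA; apply: ler_wpM2l; first exact: mulr_ge0.
    apply: ler_pM; rewrite ?exprn_ge0 ?mulr_ge0 ?ler0n //.
      by rewrite ler_weXn2l // ler1n.
    have -> : (h i + h j = (i.+1 + j.+1)%:R * (h i * h j))%R.
      rewrite /h natrD; field.
      by rewrite !nat1r !pnatr_eq0.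
    by rewrite ler_wpM2r ?mulr_ge0 // ler_nat; lia.
  rewrite natrM natrD mulrDr mulrDr.
  have e1 := le2 (N - i) ltac:(lia) ltac:(lia) lj.
  have e2 := le2 (N - i).-1.
  have [lt_iN|geiN] := ltnP i N.
    have := e2 ltac:(lia) ltac:(lia) lj'.
    move=> /(lerD e1) /le_trans; apply.
    by rewrite -mulrDr; apply: ler_wpM2l; [rewrite !mulr_ge0 ?exprn_ge0|lra].
  have Ni : N - i = 0 by lia.
  rewrite Ni /=; rewrite Ni in e1.
  move: (lerD e1 e1) => /le_trans; apply.
  by rewrite -mulrDr; apply: ler_wpM2l; [rewrite !mulr_ge0 ?exprn_ge0|lra].
have := dyadic_mul P Q N; rewrite -(@ler_nat rat) natr_sum => le1.
rewrite natrM.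
have N0 : (0 <= N.+1%:R :> rat)%R by rewrite ler0n.
apply: le_trans (ler_wpM2l N0 le1) _.
rewrite mulr_sumr.
apply: (@le_trans _ _ (\sum_(i < N.+1)
   A * B * 2 ^+ N * (2 * h i + h (N - i)%N + h (N - i)%N.-1))%R).
  by apply: ler_sum => i _; apply: key; rewrite -ltnS.
rewrite -mulr_sumr !big_split /= -mulr_sumr.
apply: (@le_trans _ _ (A * B * 2 ^+ N * (5 * K))%R).
  by apply: ler_wpM2l; [rewrite !mulr_ge0 ?exprn_ge0|lra].
rewrite !natrM !natrX /A /B -/K exprS exprD.
by rewrite le_eqVlt; apply/orP; left; apply/eqP; ring.
Qed.

(** k + 1 <= e * (k / e + 1) <= e * 2 ^ (k / e); then raise to the power e. *)
Lemma poly_le_exp2 e : exists C, forall k, k.+1 ^ e <= C * 2 ^ k.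
Proof.
case: e => [|e]; first by exists 1 => k; rewrite expn0 mul1n expn_gt0.
exists (e.+1 ^ e.+1) => k.
have le_k : k.+1 <= e.+1 * 2 ^ (k %/ e.+1).
  have := ltn_expl (k %/ e.+1) (erefl (1 < 2)).
  have := ltn_ceil k (ltn0Sn e); nia.
apply: leq_trans (_ : (e.+1 * 2 ^ (k %/ e.+1)) ^ e.+1 <= _).
  by rewrite leq_exp2r.
by rewrite expnMn -expnM leq_mul2l leq_exp2l ?leq_trunc_div ?orbT.
Qed.

Lemma poly_scaled_le_exp2 e C : exists K, forall k, K <= k -> C * k.+1 ^ e <= 2 ^ k.
Proof.
have [C' HC'] := poly_le_exp2 e.+1; exists (C * C') => k leKk.
have := HC' k; rewrite expnS; set x := k.+1 ^ e; set y := 2 ^ k => le_xy.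
have [C0|C'0] := posnP C'; first by nia.
by rewrite -(leq_pmul2l C'0); nia.
Qed.

Lemma sub_thin (P Q : pred nat) : (forall n, P n -> Q n) -> thin Q -> thin P.
Proof.
move=> sPQ [C [e HQ]]; exists C, e => k j /HQ; apply: leq_trans.
by rewrite leq_mul2l sub_count ?orbT.
Qed.

Lemma thinU (P Q : pred nat) : thin P -> thin Q -> thin (predU P Q).
Proof.
move=> [C [e HP]] [C' [e' HQ]]; exists (C + C'), (e + e') => k j ltj.
have leU : dyadic (predU P Q) j <= dyadic P j + dyadic Q j.
  by rewrite /dyadic -count_predUI leq_addr.
apply: leq_trans (leq_mul (leqnn _) leU) _; rewrite mulnDr !mulnDl.
apply: leq_add.
  apply: leq_trans (HP _ _ ltj) _.
  by rewrite leq_mul2l leq_pexp2l ?leq_addr ?orbT.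
apply: leq_trans (HQ _ _ ltj) _.
by rewrite leq_mul2l leq_pexp2l ?leq_addl ?orbT.
Qed.

Lemma thin_of_bound (P : pred nat) C :
  (forall j, j.+1 * dyadic P j <= C * 2 ^ j) -> thin P.
Proof. by move=> HP; exists C, 0 => k j _; rewrite expn0 muln1. Qed.

(** Apply thinness with 2 ^ (k - 1) <= j < 2 ^ k: the factor j + 1 on the left then
    beats the power of k + 1 on the right. *)
Lemma thin_dyadic_small (P : pred nat) m : thin P ->
  exists J, forall j, J <= j -> m * dyadic P j <= 2 ^ j.
Proof.
move=> [C [e HP]]; have [K HK] := poly_scaled_le_exp2 e (2 * (m * C)).
exists (2 ^ K) => j leKj.
have j0 : 0 < j by apply: leq_trans leKj; rewrite expn_gt0.
have /andP[] := trunc_log_bounds (erefl (1 < 2)) j0.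
set k := trunc_log 2 j => lekj ltjk.
have leKk : K <= k.+1.
  by rewrite ltnW // -(ltn_exp2l _ _ (erefl (1 < 2))); apply: leq_ltn_trans ltjk.
have := HK _ leKk; have := HP _ _ ltjk; rewrite expnS => h1 h2.
have k0 : 0 < 2 ^ k by rewrite expn_gt0.
rewrite -(leq_pmul2l k0); move: h1 h2.
set x := dyadic P j; set y := k.+2 ^ e; set z := 2 ^ k in lekj *.
set t := 2 ^ j => h1 h2.
have h3 : m * (z * x) <= m * (C * t * y).
  by rewrite leq_mul2l (leq_trans _ h1) ?orbT // leq_mul2r leqW ?orbT.
have h4 : t * (m * C * y) <= t * z by rewrite leq_mul2l; lia.
lia.
Qed.

Lemma count_iota_mono (P : pred nat) m n :
  m <= n -> count P (iota 1 m) <= count P (iota 1 n).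
Proof. by move=> /subnKC <-; rewrite iotaD count_cat leq_addr. Qed.

Lemma thin_count_small (P : pred nat) m : 0 < m -> thin P ->
  exists n0, forall n, n0 <= n -> m * count P (iota 1 n) <= n.
Proof.
move=> m0 /(thin_dyadic_small (4 * m)) [J HJ].
have bound N : 4 * m * count P (iota 1 (2 ^ N).-1) <= 4 * m * 2 ^ J + 2 ^ N.
  elim: N => [|N IHN]; first by rewrite /= muln0.
  have [leJN | ltNJ] := leqP J N.
    have -> : (2 ^ N.+1).-1 = (2 ^ N).-1 + 2 ^ N.
      by have : 0 < 2 ^ N; rewrite ?expn_gt0 // expnS; lia.
    rewrite iotaD count_cat mulnDr add1n prednK ?expn_gt0 //.
    by have := HJ N leJN; rewrite /dyadic expnS; lia.
  apply: leq_trans (leq_addr _ _); rewrite leq_mul2l; apply/orP; right.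
  apply: leq_trans (count_size _ _) _; rewrite size_iota.
  by apply: leq_trans (leq_pred _) _; rewrite leq_exp2l.
exists (2 * m * 2 ^ J).+1 => n le_n.
have n0 : 0 < n by lia.
have /andP[] := trunc_log_bounds (erefl (1 < 2)) n0.
set N := trunc_log 2 n => leNn ltnN.
have le1 : n <= (2 ^ N.+1).-1 by lia.
have := leq_mul (leqnn (4 * m)) (count_iota_mono P le1).
have := bound N.+1; rewrite expnS in ltnN *; lia.
Qed.

(** * Thinness of shifted prime powers and of Mersenne products *)

Lemma leqS_exp2 j : j.+1 <= 2 ^ j. Proof. exact: ltn_expl. Qed.

Definition pow3 : pred nat := fun n => `[< exists b, n = 3 ^ b >].

Lemma thin_pow3 : thin pow3.
Proof.
apply: (@thin_of_bound _ 1) => j; rewrite mul1n.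
have le1 : dyadic pow3 j <= 1.
  apply: (dyadic_bound (s := [:: 3 ^ trunc_log 3 (2 ^ j.+1).-1])).
  move=> n /asboolP[b ->] /andP[lejb ltbj].
  rewrite inE (@trunc_log_eq 3 b) //.
  by rewrite expnS in ltbj *; rewrite expnS; lia.
by apply: leq_trans (leqS_exp2 j); rewrite -[leqRHS]muln1 leq_mul2l le1 orbT.
Qed.

(** The factor 3 = 2 ^ 2 - 1 is left out and treated apart as pow3: with it the
    bound of count_mersenne_prod_rec would only yield growth 2 ^ j. *)
Definition mersenne_prod : pred nat := fun n =>
  `[< exists2 s : seq nat, all (leq 3) s & n = \prod_(m <- s) (2 ^ m).-1 >].

(** Remove one factor 2 ^ m - 1, which is at least 2 ^ (m - 1): the cofactor
    is below 2 ^ i with i = j + 2 - m, and m >= 3 means i < j. *)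
Lemma count_mersenne_prod_rec j :
  count mersenne_prod (iota 1 (2 ^ j.+1).-1) <=
    1 + \sum_(i < j) count mersenne_prod (iota 1 (2 ^ i).-1).
Proof.
pose F i := [seq n <- iota 1 (2 ^ i).-1 | mersenne_prod n].
pose L := 1 :: flatten
  [seq [seq (2 ^ (j.+2 - i)).-1 * d | d <- F i] | i <- iota 0 j].
suff: size (F j.+1) <= size L.
  rewrite size_filter /= size_flatten /shape -map_comp sumnE big_map.
  rewrite (_ : iota 0 j = index_iota 0 j); last by rewrite /index_iota subn0.
  rewrite big_mkord => /leq_trans; apply.
  by rewrite add1n ltnS leq_sum // => i _ /=; rewrite size_map size_filter.
apply: uniq_leq_size; first by rewrite filter_uniq ?iota_uniq.
have in_iota d i : 0 < d < 2 ^ i -> d \in iota 1 (2 ^ i).-1.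
  by have : 0 < 2 ^ i; rewrite ?expn_gt0 // mem_iota; lia.
move=> n; rewrite mem_filter mem_iota => /andP[/asboolP[s] s3 ->].
case: s s3 => [|m s] /=; first by rewrite big_nil mem_head.
rewrite big_cons => /andP[m3 s3]; set d := \prod_(i <- s) _ => lt_md.
rewrite inE; apply/orP; right.
have pm : 0 < 2 ^ m.-1 by rewrite expn_gt0.
have Em : 2 ^ m = 2 * 2 ^ m.-1 by rewrite -expnS prednK //; lia.
have lt_d : 2 ^ m.-1 * d < 2 ^ j.+1 by nia.
have d0 : 0 < d by nia.
have lt_mj : m.-1 < j.+1.
  rewrite -(ltn_exp2l _ _ (erefl (1 < 2))); apply: leq_ltn_trans lt_d.
  by rewrite leq_pmulr.
have Ej : 2 ^ j.+1 = 2 ^ m.-1 * 2 ^ (j.+2 - m).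
  by rewrite -expnD; congr (2 ^ _); lia.
rewrite Ej ltn_pmul2l // in lt_d.
apply/flatten_mapP; exists (j.+2 - m); first by rewrite mem_iota; lia.
rewrite subKn; last by lia.
apply: map_f; rewrite mem_filter in_iota ?d0 // andbT.
by apply/asboolP; exists s.
Qed.

(** The recursion above gives Fibonacci growth; 7 / 4 is a convenient rate between
    the golden ratio and 2. *)
Lemma count_mersenne_prod_le j :
  4 ^ j * count mersenne_prod (iota 1 (2 ^ j).-1) <= 7 ^ j.
Proof.
suff H : ((count mersenne_prod (iota 1 (2 ^ j).-1))%:R <= (7 / 4) ^+ j :> rat)%R.
  rewrite -(@ler_nat rat) natrM !natrX mulrC -ler_pdivlMr ?exprn_gt0 //.
  by rewrite -expr_div_n.
elim/ltn_ind: j => -[_ /=|j IHj]; first by rewrite expr0.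
have := count_mersenne_prod_rec j; rewrite -(@ler_nat rat) natrD natr_sum.
move=> /le_trans; apply.
apply: (@le_trans _ _ (1 + \sum_(i < j) (7 / 4) ^+ i)%R).
  by rewrite lerD2l ler_sum // => i _; apply: IHj; apply: ltnW; rewrite ltnS.
elim: j {IHj} => [|j IHj]; first by rewrite big_ord0; lra.
rewrite big_ord_recr /= addrA; apply: le_trans (lerD IHj (lexx _)) _.
have : (0 <= (7 / 4 : rat) ^+ j)%R by apply: exprn_ge0; lra.
rewrite !exprS.
by move: (_ ^+ _)%R => x; lra.
Qed.

Lemma thin_mersenne_prod : thin mersenne_prod.
Proof.
have e78 j : j.+1 * 7 ^ j <= 7 * 8 ^ j.
  elim: j => // j; rewrite !expnS.
  have : 7 ^ j <= 8 ^ j by case: j => // j; rewrite leq_exp2r.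
  by move: (7 ^ j) (8 ^ j) => x y; lia.
(* (j + 1) (7 / 4) ^ (j + 1) <= 7 * (7 / 4) * 2 ^ j, and 49 / 4 <= 13. *)
apply: (@thin_of_bound _ 13) => j.
have leD : dyadic mersenne_prod j <= count mersenne_prod (iota 1 (2 ^ j.+1).-1).
  apply: leq_trans (dyadic_bound (s := [seq n <- iota 1 (2 ^ j.+1).-1 | mersenne_prod n]) _) _.
    move=> n Mn /andP[len ltn]; rewrite mem_filter Mn mem_iota /=.
    have : 0 < 2 ^ j by rewrite expn_gt0.
    lia.
  by rewrite size_filter.
have := count_mersenne_prod_le j.+1; have := e78 j; rewrite [4 ^ j.+1]expnS [7 ^ j.+1]expnS.
have -> : 8 ^ j = 4 ^ j * 2 ^ j by rewrite -expnMn.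
move: leD; set x := dyadic _ _; set y := count _ _ => le_xy h1 h2.
have a0 : 0 < 4 ^ j by rewrite expn_gt0.
rewrite -(leq_pmul2l a0); move: h1 h2 a0.
set a := 4 ^ j; set b := 7 ^ j; set c := 2 ^ j => h1 h2 a0.
have h3 : 4 * a * x <= 7 * b by apply: leq_trans h2; rewrite leq_mul2l le_xy orbT.
have h4 : j.+1 * (4 * a * x) <= j.+1 * (7 * b) by rewrite leq_mul2l h3 orbT.
lia.
Qed.

Lemma prod_primes_dvd (s : seq nat) m :
  uniq s -> all prime s -> all (dvdn^~ m) s -> \prod_(p <- s) p %| m.
Proof.
elim: s => [|p s IHs] /=; first by rewrite big_nil dvd1n.
move=> /andP[p_s us] /andP[pp ps] /andP[pm sm].
rewrite big_cons Gauss_dvd ?pm ?IHs // prime_coprime // Euclid_dvd_prod // big_has.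
apply: contra p_s => /hasP[q qs]; rewrite dvdn_prime2 //; last exact: allP ps _ qs.
by move=> /eqP ->.
Qed.

Definition shifted_prime : pred nat := fun n => prime n.+1.

(** With M = 2 ^ j, the primes in ]M, 2M] all divide 'C(2M, M) <= 4 ^ M, and each of
    them exceeds 2 ^ j. *)
Lemma chebyshev_dyadic j : j * dyadic shifted_prime j <= 2 ^ j.+1.
Proof.
pose s := [seq n.+1 | n <- iota (2 ^ j) (2 ^ j) & shifted_prime n].
set M := 2 ^ j.
have s_dvd : \prod_(p <- s) p %| 'C(2 * M, M).
  apply: prod_primes_dvd.
  - rewrite map_inj_uniq ?filter_uniq ?iota_uniq //; exact: succn_inj.
  - by apply/allP => p /mapP[n]; rewrite mem_filter => /andP[pn _] ->.
  apply/allP => p /mapP[n]; rewrite mem_filter mem_dyadic.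
  move=> /andP[pn /andP[len ltn]] ->; rewrite expnS -/M in ltn.
  have : n.+1 %| (2 * M)`! by rewrite dvdn_fact.
  rewrite -(@bin_fact (2 * M) M); last by lia.
  rewrite (_ : 2 * M - M = M); last by lia.
  have nM : ~~ (n.+1 %| M`!).
    rewrite fact_prod (Euclid_dvd_prod _ _ _ pn) big_has.
    apply/negP => /hasP[i].
    by rewrite mem_index_iota => /andP[i0 iM] /dvdn_leq; rewrite -/M in len; lia.
  by rewrite !(Euclid_dvdM _ _ pn) (negPf nM) !orbF.
have C_le : 'C(2 * M, M) <= 2 ^ (2 * M).
  have M2 : M < (2 * M).+1 by lia.
  rewrite (_ : 2 ^ (2 * M) = (1 + 1) ^ (2 * M)) // expnDn (bigD1 (Ordinal M2)) //=.
  by rewrite !exp1n !muln1 leq_addr.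
have C0 : 0 < 'C(2 * M, M) by rewrite bin_gt0; lia.
rewrite -(leq_exp2l _ _ (erefl (1 < 2))) [2 ^ j.+1]expnS -/M.
apply: leq_trans C_le; apply: leq_trans (dvdn_leq C0 s_dvd).
rewrite big_map /dyadic -size_filter expnM -/M.
have : all (leq M) [seq n <- iota M M | shifted_prime n].
  by apply/allP => n; rewrite mem_filter mem_iota => /and3P[].
elim: [seq _ <- _ | _] => [|n l IHl] /=; first by rewrite big_nil.
move=> /andP[leM /IHl le_l]; rewrite big_cons expnS.
by apply: leq_mul le_l; apply: leqW.
Qed.

Definition prime_power (q : nat) : Prop := exists p a, [/\ prime p, 0 < a & q = p ^ a].

Definition shifted_ppow : pred nat := fun n => `[< prime_power n.+1 >].

Definition shifted_power : pred nat := fun n =>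
  `[< exists p a, [/\ 1 < p, 1 < a & n.+1 = p ^ a] >].

Lemma thin_shifted_prime : thin shifted_prime.
Proof.
apply: (@thin_of_bound _ 3) => j.
have := chebyshev_dyadic j; rewrite expnS.
have : dyadic shifted_prime j <= 2 ^ j.
  by apply: leq_trans (count_size _ _) _; rewrite size_iota.
by move: (2 ^ j) => x *; nia.
Qed.

(** A proper power p ^ a at most 2 ^ (j + 1) has p at most about 2 ^ (j / 2) and
    a <= j + 1, so there are O(j 2 ^ (j / 2)) of them. *)
Lemma thin_shifted_power : thin shifted_power.
Proof.
have [C HC] := poly_le_exp2 2.
apply: (@thin_of_bound _ (24 * C)) => j.
set h := j./2.
have le_j : j <= 2 * h + 1 by rewrite /h; lia.
have le_h : 2 * h <= j by rewrite /h; lia.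
have : dyadic shifted_power j <= (2 ^ h.+1).+1 * j.+2.
  apply: leq_trans (dyadic_bound (s := [seq (p ^ a).-1 |
    p <- iota 0 (2 ^ h.+1).+1, a <- iota 0 j.+2]) _) _; last first.
    by rewrite size_allpairs !size_iota.
  move=> n /asboolP[p [a [p1 a1 En]]] /andP[_]; rewrite -[n < _]/(n.+1 <= _).
  rewrite -[n in n \in _]/(n.+1.-1) En => le_pa.
  apply: allpairs_f; rewrite mem_iota /= add0n ltnS.
    rewrite -(@leq_exp2r _ _ 2) // -expnM.
    apply: leq_trans (_ : p ^ a <= _); first by rewrite leq_pexp2l //; lia.
    by apply: leq_trans le_pa _; rewrite leq_exp2l //; lia.
  rewrite -(leq_exp2l _ _ (erefl (1 < 2))); apply: leq_trans le_pa.
  by rewrite leq_exp2r //; lia.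
have le1 : 2 ^ h * 2 ^ h <= 2 ^ j by rewrite -expnD leq_exp2l //; lia.
have h0 : 0 < 2 ^ h by rewrite expn_gt0.
have := HC h; rewrite [2 ^ h.+1]expnS; move: le1 h0.
set x := 2 ^ h; set y := 2 ^ j; set z := dyadic _ _ => le1 x0 h1 h2.
have h3 : z <= 3 * x * j.+2 by apply: leq_trans h2 _; rewrite leq_mul2r; lia.
have h4 : j.+1 * j.+2 <= 8 * h.+1 ^ 2 by rewrite -mulnn; nia.
have h5 : j.+1 * z <= 3 * x * (8 * h.+1 ^ 2).
  apply: leq_trans (leq_mul (leqnn _) h3) _.
  by rewrite mulnCA leq_mul2l h4 orbT.
apply: leq_trans h5 _.
have h6 : x * (C * x) <= C * y by rewrite mulnCA leq_mul2l le1 orbT.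
have h7 : x * h.+1 ^ 2 <= x * (C * x) by rewrite leq_mul2l h1 orbT.
lia.
Qed.

Lemma thin_shifted_ppow : thin shifted_ppow.
Proof.
apply: sub_thin (thinU thin_shifted_prime thin_shifted_power) => n /asboolP[p [a [pp a0 En]]].
apply/orP; rewrite /= /shifted_prime.
have [a1 | a1] := leqP a 1.
  by left; rewrite En (_ : a = 1) ?expn1 //; lia.
by right; apply/asboolP; exists p, a; rewrite prime_gt1.
Qed.

(** * Products of numbers q - 1 have density zero *)

Definition mersenne3_prod : pred nat := mulpred pow3 mersenne_prod.

(** As 1 = 2 - 1 is a shifted prime power, k shifted factors stand for at most k odd
    prime powers. *)
Definition few_shifts k : pred nat := iter k (mulpred shifted_ppow) mersenne3_prod.

Lemma thin_few_shifts k : thin (few_shifts k).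
Proof.
elim: k => [|k IHk] /=; first exact: thin_mul thin_pow3 thin_mersenne_prod.
exact: thin_mul thin_shifted_ppow IHk.
Qed.

Lemma few_shifts_mersenne k m n :
  0 < m -> few_shifts k n -> few_shifts k ((2 ^ m).-1 * n).
Proof.
move=> m0; elim: k n => [|k IHk] n /asboolP[d [e [Pd Pe ->]]]; last first.
  apply/asboolP; exists d, ((2 ^ m).-1 * e); split=> //; last by rewrite mulnCA.
  exact: IHk.
have [m3 | ] := leqP 3 m.
  apply/asboolP; exists d, ((2 ^ m).-1 * e); split=> //; last by rewrite mulnCA.
  case/asboolP: Pe => s s3 ->; apply/asboolP; exists (m :: s); last by rewrite big_cons.
  by rewrite /= m3.
case: m m0 => [|[|[|m]]] // _ _.
  by rewrite mul1n; apply/asboolP; exists d, e.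
apply/asboolP; exists (3 * d), e; split=> //; last by rewrite mulnA.
by case/asboolP: Pd => b ->; apply/asboolP; exists b.+1; rewrite expnS.
Qed.

Definition shifted_product (n : nat) : Prop :=
  exists2 s : seq nat, (forall q, q \in s -> prime_power q) & n = \prod_(q <- s) q.-1.

Lemma shifted_productM m n : shifted_product m -> shifted_product n -> shifted_product (m * n).
Proof.
move=> [s sp ->] [t tp ->]; exists (s ++ t); last by rewrite big_cat.
by move=> q; rewrite mem_cat => /orP[/sp|/tp].
Qed.

Lemma shifted_product_3smooth m :
  0 < m -> (forall p, prime p -> p %| m -> p <= 3) -> shifted_product m.
Proof.
elim/ltn_ind: m => m IHm m0 m3; have [m1|m1] := leqP m 1.
  by exists [::]; rewrite ?big_nil //; lia.
have pp := pdiv_prime m1; have pm := pdiv_dvd m; have p3 := m3 _ pp pm.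
set p := pdiv m in pp pm p3; rewrite -(divnK pm).
apply: shifted_productM.
  apply: IHm; first by rewrite ltn_Pdiv ?prime_gt1.
    by rewrite divn_gt0 ?prime_gt0 // dvdn_leq.
  by move=> q pq qm; apply: m3 => //; apply: dvdn_trans qm (dvdn_div pm).
exists [:: p.+1]; last by rewrite big_seq1.
move=> q; rewrite inE => /eqP ->; have p2 := prime_gt1 pp.
have [->|->] : p = 2 \/ p = 3 by lia.
  by exists 3, 1.
by exists 2, 2.
Qed.

(** Each odd q uses up one factor 2 of n, and each even q is a Mersenne factor. *)
Lemma shifted_product_few_shifts k n : shifted_product n -> ~~ (2 ^ k %| n) -> few_shifts k n.
Proof.
move=> [s ps ->]; elim: s k ps => [|q s IHs] k ps.
  rewrite big_nil => _; elim: k => [|k IHk]; apply/asboolP; exists 1, 1; split=> //.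
  - by apply/asboolP; exists 0.
  - by apply/asboolP; exists [::]; rewrite ?big_nil.
  - by apply/asboolP; exists 2, 1.
have ps' q' : q' \in s -> prime_power q'.
  by move=> qs; apply: ps; rewrite inE qs orbT.
have {}IHs k' := IHs k' ps'.
have [p [a [pp a0 Eq]]] := ps q (mem_head _ _).
rewrite big_cons; have [p2 | p_odd] := even_prime pp.
  rewrite Eq p2 => nk; apply: few_shifts_mersenne => //; apply: IHs.
  by apply: contra nk; apply: dvdn_mull.
case: k => [|k]; first by rewrite expn0 dvd1n.
move=> nk; apply/asboolP; exists q.-1, (\prod_(j <- s) j.-1); split=> //.
  by apply/asboolP; exists p, a; rewrite prednK // Eq expn_gt0 prime_gt0.
apply: IHs; apply: contra nk; rewrite expnS; apply: dvdn_mul.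
have q0 : 0 < q by rewrite Eq expn_gt0 prime_gt0.
have : odd q by rewrite Eq oddX p_odd orbT.
by rewrite -{1}(prednK q0) dvdn2.
Qed.

Lemma count_dvd d n : 0 < d -> count (dvdn d) (iota 1 n) = n %/ d.
Proof.
move=> d0; elim: n => [|n IHn]; first by rewrite div0n.
by rewrite -[n.+1 in LHS]addn1 iotaD count_cat IHn /= addn0 add1n divnS // addnC.
Qed.

(** The level 2 m is chosen so that multiples of 2 ^ (2 m) account for at most
    n / (2 m) of the integers up to n. *)
Lemma shifted_product_count_small m : 0 < m -> exists n0, forall n, n0 <= n ->
  m * count (fun k => `[< shifted_product k >]) (iota 1 n) <= n.
Proof.
move=> m0; have m2 : 0 < 2 * m by lia.
have [n0 Hn0] := thin_count_small m2 (thin_few_shifts (2 * m)).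
exists n0 => n le_n; have := Hn0 n le_n.
have le_c : count (fun k => `[< shifted_product k >]) (iota 1 n) <=
    count (few_shifts (2 * m)) (iota 1 n) + n %/ 2 ^ (2 * m).
  rewrite -count_dvd ?expn_gt0 // -count_predUI; apply: leq_trans (leq_addr _ _).
  apply: sub_count => k /asboolP Sk; apply/orP => /=.
  by case: (boolP (_ %| k)) => [|/(shifted_product_few_shifts Sk)]; [right | left].
have := leqS_exp2 (2 * m); have := leq_trunc_div n (2 ^ (2 * m)).
move: le_c; set x := count _ _; set y := count _ _; set z := _ %/ _.
by move: (2 ^ _) => w *; nia.
Qed.

(** * Finite groups carried by sequences of ring elements *)

Section AdditiveGroup.
Local Open Scope ring_scope.
Variables (A : zmodType) (s : seq A).

Definition sub_closed := forall x y, x \in s -> y \in s -> x - y \in s.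

(** The closure proofs are arguments of the type so that it can carry the group
    structure that they justify. *)
Definition add_group_on (_ : 0 \in s) (_ : sub_closed) : Type := seq_sub s.

Variables (s0 : 0 \in s) (sB : sub_closed).

Lemma mem_oppr x : x \in s -> - x \in s.
Proof. by rewrite -[- x]add0r; apply: sB. Qed.

Lemma mem_addr x y : x \in s -> y \in s -> x + y \in s.
Proof. by move=> sx sy; rewrite -[y]opprK sB ?mem_oppr. Qed.

Notation gT := (add_group_on s0 sB).

Let add (x y : gT) : gT := SeqSub (mem_addr (ssvalP x) (ssvalP y)).
Let opp (x : gT) : gT := SeqSub (mem_oppr (ssvalP x)).
Let zero : gT := SeqSub s0.

Fact add_group_addA : associative add.
Proof. by move=> x y z; apply: val_inj; rewrite /= addrA. Qed.
Fact add_group_add0 : left_id zero add.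
Proof. by move=> x; apply: val_inj; rewrite /= add0r. Qed.
Fact add_group_addN : left_inverse zero opp add.
Proof. by move=> x; apply: val_inj; rewrite /= addNr. Qed.

HB.instance Definition _ := Finite.on gT.
HB.instance Definition _ :=
  Finite_isGroup.Build gT add_group_addA add_group_add0 add_group_addN.

Lemma additive_Cauchy p : uniq s -> prime p -> (p %| size s)%N ->
  exists x, [/\ x \in s, x != 0 & x *+ p = 0].
Proof.
move=> us pp; rewrite -(card_seq_sub us) => ps.
have ps' : (p %| #|[set: gT]|)%N by rewrite cardsT.
have [x _ xp] := Cauchy pp ps'.
have valX n : ssval (x ^+ n)%g = ssval x *+ n.
  by elim: n => [|n IHn]; rewrite ?expgS ?mulrS //= IHn.
exists (ssval x); split; first exact: ssvalP.
  apply: contraTneq (prime_gt1 pp) => x0.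
  by rewrite -xp (_ : x = 1%g) ?order1 //; apply: val_inj.
by rewrite -valX -xp expg_order.
Qed.

End AdditiveGroup.

Section UnitGroup.
Local Open Scope ring_scope.
Variables (A : comUnitRingType) (U : seq A).

Definition unit_group_on (_ : forall u, (u \in U) = (u \is a GRing.unit)) : Type :=
  seq_sub U.

Variable UP : forall u, (u \in U) = (u \is a GRing.unit).

Lemma unit_seqM x y : x \in U -> y \in U -> x * y \in U.
Proof. by rewrite !UP unitrM => -> ->. Qed.
Lemma unit_seqV x : x \in U -> x^-1 \in U.
Proof. by rewrite !UP unitrV. Qed.
Lemma unit_seq1 : 1 \in U. Proof. by rewrite UP unitr1. Qed.

Notation gT := (unit_group_on UP).

Let mul (x y : gT) : gT := SeqSub (unit_seqM (ssvalP x) (ssvalP y)).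
Let inv (x : gT) : gT := SeqSub (unit_seqV (ssvalP x)).
Let one : gT := SeqSub unit_seq1.

Fact unit_group_mulA : associative mul.
Proof. by move=> x y z; apply: val_inj; rewrite /= mulrA. Qed.
Fact unit_group_mul1 : left_id one mul.
Proof. by move=> x; apply: val_inj; rewrite /= mul1r. Qed.
Fact unit_group_mulV : left_inverse one inv mul.
Proof.
by move=> x; apply: val_inj; rewrite /= mulVr //; have := ssvalP x; rewrite UP.
Qed.

HB.instance Definition _ := Finite.on gT.
HB.instance Definition _ :=
  Finite_isGroup.Build gT unit_group_mulA unit_group_mul1 unit_group_mulV.

Let valX (x : gT) n : ssval (x ^+ n)%g = ssval x ^+ n.
Proof. by elim: n => [|n IHn]; rewrite ?expgS ?exprS //= IHn. Qed.

Hypothesis uU : uniq U.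

Lemma unit_seq_expr u : u \in U -> u ^+ size U = 1.
Proof.
move=> uin; have := expg_cardG (finset.in_setT (SeqSub uin : gT)).
rewrite cardsT (card_seq_sub uU) => /(congr1 (@ssval _ _)).
by rewrite valX.
Qed.

Variable H : pred A.
Hypotheses (H1 : H 1) (HM : forall x y, H x -> H y -> H (x * y)).

(** Cauchy's theorem in the quotient of U by H: an element of prime order p > n
    there would be the class of some u outside H with u ^ p in H. *)
Lemma index_primes_le (n : nat) :
  (forall p u, prime p -> (n < p)%N -> u \in U -> H (u ^+ p) -> H u) ->
  exists2 m, size U = (count H U * m)%N &
    forall p, prime p -> (p %| m)%N -> (p <= n)%N.
Proof.
move=> Hp; pose Hs := [set x : gT | H (ssval x)].
have gHs : group_set Hs.
  by apply/group_setP; split=> [|x y]; rewrite !inE //=; apply: HM.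
pose K := group gHs.
have cHs : #|K| = count H U.
  rewrite -size_filter cardE -(size_map (@ssval _ _)); apply/perm_size/uniq_perm.
  - by rewrite map_inj_uniq ?enum_uniq //; apply: val_inj.
  - exact: filter_uniq.
  move=> x; rewrite mem_filter; apply/mapP/andP => [[y]|[Hx Ux]].
    by rewrite mem_enum inE => Hy ->; split=> //; apply: ssvalP.
  by exists (SeqSub Ux); rewrite ?mem_enum ?inE.
have ab : abelian [set: gT].
  apply/centsP => x _ y _; apply: val_inj; exact: mulrC.
have nK : normal K [set: gT] by rewrite -sub_abelian_normal ?finset.subsetT.
exists (indexg [set: gT] K).
  by rewrite -cHs Lagrange ?finset.subsetT // cardsT (card_seq_sub uU).
move=> p pp; rewrite leqNgt -card_quotient ?normal_norm // => pdiv.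
apply/negP => ltnp.
have [xb /morphimP[x Nx _ Exb] ox] := Cauchy pp pdiv.
have xpK : (x ^+ p)%g \in K.
  by apply: coset_idr; rewrite ?groupX // morphX //= -Exb -ox expg_order.
have xK : x \in K.
  move: xpK; rewrite !inE valX; apply: Hp => //; exact: ssvalP.
have := prime_gt1 pp; rewrite -ox Exb /= coset_id //.
by rewrite order1.
Qed.

End UnitGroup.

(** * Units of order a power of a prime p > 3 *)

Section Bass.
Local Open Scope ring_scope.

(** Both z and 1 + z lie on the unit circle, so 1 + z + z^* = 0, which forces
    z ^ 3 = 1; as p is prime to 3, z = 1. *)
Lemma one_add_root_of_unity (p K : nat) (z : algC) :
  prime p -> (3 < p)%N -> (0 < K)%N -> z ^+ p = 1 -> (1 + z) ^+ K = 1 -> z = 1.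
Proof.
move=> pp p3 K0 zp1 zK1.
have p0 : (0 < p)%N by apply: prime_gt0.
have nz : z * z^* = 1.
  rewrite -normCK; apply/eqP; rewrite -(@pexpr_eq1 _ _ p) ?exprn_ge0 //.
  by rewrite exprAC -normrX zp1 normr1 expr1n.
have n1z : (1 + z) * (1 + z^*) = 1.
  rewrite -[1 in X in _ * X]conjC1 -rmorphD -normCK; apply/eqP.
  rewrite -(@pexpr_eq1 _ _ K) ?exprn_ge0 //.
  by rewrite exprAC -normrX zK1 normr1 expr1n.
have z2 : z ^+ 2 + z + 1 = 0.
  have -> : z ^+ 2 + z + 1 = z * ((1 + z) * (1 + z^*) - 1) - (z + 1) * (z * z^* - 1).
    by ring.
  by rewrite n1z nz !subrr !mulr0 subrr.
have z3 : z ^+ 3 = 1.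
  have -> : z ^+ 3 = 1 + (z - 1) * (z ^+ 2 + z + 1) by ring.
  by rewrite z2 mulr0 addr0.
have : (p %% 3 != 0)%N.
  rewrite -[(_ != _)%N]/(~~ (3 %| p)%N) dvdn_prime2 //.
  by apply: contraTneq p3 => <-.
have : (p %% 3 < 3)%N by rewrite ltn_mod.
have := expr_mod p z3; rewrite zp1.
case: (p %% 3)%N => [|[|[|]]] // E _ _.
by have := z3; rewrite exprS E mulr1.
Qed.

(** By one_add_root_of_unity, the two polynomials have no common complex root, so
    they are coprime over the rationals; clear denominators. *)
Lemma int_Bezout_cyclotomic (p K : nat) : prime p -> (3 < p)%N -> (0 < K)%N ->
  exists (u v : {poly int}) (m : int), m != 0 /\
    u * ((1 + 'X) ^+ K - 1) + v * (\sum_(i < p) 'X^i) = m%:P.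
Proof.
move=> pp p3 K0.
pose f (R : nzRingType) : {poly R} := (1 + 'X) ^+ K - 1.
pose g (R : nzRingType) : {poly R} := \sum_(i < p) 'X^i.
have mapf (R R' : nzRingType) (h : {rmorphism R -> R'}) : map_poly h (f R) = f R'.
  by rewrite /f rmorphB rmorphXn rmorphD /= rmorph1 map_polyX.
have mapg (R R' : nzRingType) (h : {rmorphism R -> R'}) : map_poly h (g R) = g R'.
  by rewrite /g rmorph_sum; apply: eq_bigr => i _; rewrite /= map_polyXn.
have cop : coprimep (f rat) (g rat).
  rewrite -(coprimep_map (@ratr algC)) mapf mapg.
  rewrite coprimep_def; apply/negPn/negP => /closed_rootP[z].
  rewrite root_gcd => /andP[/rootP fz /rootP gz].
  move: fz gz; rewrite /f /g !hornerE horner_sum => /subr0_eq fz gz.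
  have gz' : \sum_(i < p) z ^+ i = 0.
    by rewrite -[RHS]gz; apply: eq_bigr => i _; rewrite hornerXn.
  have zp : z ^+ p = 1 by apply/subr0_eq; rewrite subrX1 gz' mulr0.
  have z1 := one_add_root_of_unity pp p3 K0 zp fz.
  move/eqP: gz'; rewrite z1 (eq_bigr (fun _ => 1)) => [|i _]; last by rewrite expr1n.
  by rewrite sumr_const card_ord pnatr_eq0 -leqn0 leqNgt prime_gt0.
have /Bezout_eq1_coprimepP[[u v] /= uv1] := cop.
have [u' [a a0 Eu]] := rat_poly_scale u.
have [v' [b b0 Ev]] := rat_poly_scale v.
exists (b%:P * u'), (a%:P * v'), (a * b); split; first by rewrite mulf_neq0.
have inj : injective (map_poly (intr : int -> rat)).
  by apply: map_inj_poly => //; apply: intr_inj.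
apply: inj; rewrite -/(f int) -/(g int).
have := mapf _ _ (intr : {rmorphism int -> rat}).
have := mapg _ _ (intr : {rmorphism int -> rat}).
move: (f int) (g int) (f rat) (g rat) uv1 => fi gi fr gr uv1 Eg Ef.
rewrite !(rmorphD, rmorphM) /= Ef Eg !map_polyC /=.
rewrite -[RHS]mulr1 -uv1 Eu Ev !mulrDr -!mul_polyC.
have aV : a%:~R%:P * (a%:~R^-1)%:P = 1 :> {poly rat}.
  by rewrite -polyCM divff // intr_eq0.
have bV : b%:~R%:P * (b%:~R^-1)%:P = 1 :> {poly rat}.
  by rewrite -polyCM divff // intr_eq0.
congr (_ + _).
  rewrite !mulrA; congr (_ * _); congr (_ * _).
  by rewrite mulrAC aV mul1r.
rewrite !mulrA; congr (_ * _); congr (_ * _).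
by rewrite -mulrA bV mulr1.
Qed.

(** The Bass cyclic unit b = (1 + v) ^ k - j * S, where S is the sum of the powers of
    v.  Modulo S, 1 + v is inverted by g = 1 + v ^ 2 + v ^ 4 + ... + v ^ (2 h - 2)
    with 2 h = n + 1, since (1 + v) g = 1 + S.  For k = totient n, both 2 ^ k and
    h ^ k are 1 modulo n, and the corrections -j S and -j' S to (1 + v) ^ k and
    g ^ k make the product exactly 1.  On elements killed by S, b acts as
    (1 + v) ^ k. *)
Lemma Bass_unit (A : comUnitRingType) (v : A) (n : nat) :
  odd n -> v ^+ n = 1 ->
  exists b k, [/\ (0 < k)%N, b \is a GRing.unit &
    forall w, (\sum_(i < n) v ^+ i) * w = 0 -> b * w = (1 + v) ^+ k * w].
Proof.
move=> n_odd vn.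
have n0 : (0 < n)%N by case: n n_odd {vn}.
pose S := \sum_(i < n) v ^+ i.
pose h := n.+1./2.
pose g := \sum_(i < h) (v ^+ 2) ^+ i.
pose k := totient n.
have Eh : (2 * h = n.+1)%N by rewrite /h mul2n -[RHS]odd_double_half /= n_odd.
have eul x : (0 < x)%N -> coprime x n -> exists j, (x ^ k = j * n + 1)%N.
  move=> x0 co; have {}x0 : (0 < x ^ k)%N by rewrite expn_gt0 x0.
  have := Euler_exp_totient co => /eqP; rewrite eqn_mod_dvd // => /dvdnP[j Ej].
  by exists j; rewrite -Ej subnK.
have [j Ej] : exists j, (2 ^ k = j * n + 1)%N by apply: eul; rewrite ?coprime2n.
have [j' Ej'] : exists j', (h ^ k = j' * n + 1)%N.
  have : coprime (2 * h) n by rewrite Eh coprimeSn.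
  by rewrite coprimeMl => /andP[_]; apply: eul; lia.
have Sv : v * S = S.
  apply/subr0_eq; rewrite -[X in _ - X]mul1r -mulrBl -subrX1 vn subrr.
  by [].
have Sg : (1 + v) * g = 1 + S.
  have e1 m : (1 + v) * \sum_(i < m) (v ^+ 2) ^+ i = \sum_(i < 2 * m) v ^+ i.
    elim: m => [|m IHm]; first by rewrite muln0 !big_ord0 mulr0.
    rewrite big_ord_recr mulrDr IHm (_ : 2 * m.+1 = (2 * m).+2)%N; last by lia.
    by rewrite !big_ord_recr /= -exprM exprS; ring.
  by rewrite /g e1 Eh big_ord_recr /= vn addrC.
have vS m : v ^+ m * S = S by elim: m => [|m IHm]; rewrite ?mul1r // exprSr -mulrA Sv.
have SS : S * S = n%:R * S.
  rewrite {1}/S mulr_suml (eq_bigr (fun _ => S)) => [|i _]; last exact: vS.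
  by rewrite sumr_const card_ord mulr_natl.
have gS : g * S = h%:R * S.
  rewrite /g mulr_suml (eq_bigr (fun _ => S)) => [|i _]; last by rewrite -exprM vS.
  by rewrite sumr_const card_ord mulr_natl.
have gkS m : g ^+ m * S = (h ^ m)%:R * S.
  elim: m => [|m IHm]; first by rewrite expn0.
  by rewrite exprSr -mulrA gS mulrCA IHm mulrA -natrM expnS.
have vkS m : (1 + v) ^+ m * S = (2 ^ m)%:R * S.
  elim: m => [|m IHm]; first by rewrite expn0.
  rewrite exprSr -mulrA (_ : (1 + v) * S = 2%:R * S); last by rewrite mulrDl Sv; ring.
  by rewrite mulrCA IHm mulrA -natrM expnS.
have tP m : exists t, (t * n + 1 = n.+1 ^ m)%N /\ (1 + S) ^+ m = 1 + t%:R * S.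
  elim: m => [|m [t [Et tS]]]; first by exists 0%N; rewrite mul0r addr0.
  exists (t * n + t + 1)%N; split; first by rewrite expnS -Et; ring.
  rewrite exprSr tS !natrD natrM.
  have -> : (1 + t%:R * S) * (1 + S) = 1 + (t%:R * S + S) + t%:R * (S * S) by ring.
  by rewrite SS; ring.
have [t [Et tS]] := tP k.
have tE : t = (j + j' + j * j' * n)%N.
  apply/eqP; rewrite -(eqn_pmul2r n0) -(eqn_add2r 1) Et -Eh expnMn Ej Ej'.
  by apply/eqP; ring.
pose b := (1 + v) ^+ k - j%:R * S.
pose b' := g ^+ k - j'%:R * S.
have bb' : b * b' = 1.
  have -> : b * b' = ((1 + v) * g) ^+ k - j'%:R * ((1 + v) ^+ k * S)
     - j%:R * (g ^+ k * S) + j%:R * j'%:R * (S * S).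
    by rewrite /b /b' exprMn; ring.
  rewrite Sg tS vkS gkS SS Ej Ej' tE !natrD !natrM.
  by ring.
exists b, k; split; first by rewrite totient_gt0.
  by apply/unitrPr; exists b'.
by move=> w Sw; rewrite mulrBl -mulrA Sw mulr0 subr0.
Qed.

(** Put w = (v - 1) *+ c.  It is killed by the sum of the v ^ i for i < p, hence by
    the sum over all powers of v, so the Bass unit, which has finite order, shows
    that (1 + v) ^ K * w = w for some K > 0.  So w is killed by the values at v of
    1 + X + ... + X ^ (p - 1) and (1 + X) ^ K - 1, and the Bezout relation between
    these polynomials makes w torsion. *)
Lemma torsion_descent (A : comUnitRingType) (v : A) (M p e c : nat) :
  prime p -> (3 < p)%N -> (0 < M)%N ->
  (forall u : A, u \is a GRing.unit -> u ^+ M = 1) ->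
  v ^+ (p ^ e) = 1 -> (v ^+ p - 1) *+ c = 0 ->
  exists2 m, (0 < m)%N & (v - 1) *+ (c * m) = 0.
Proof.
move=> pp p3 M0 UM ve vp; pose w := (v - 1) *+ c.
have p0 : (0 < p)%N by apply: prime_gt0.
pose F := \sum_(i < p) v ^+ i.
have Fw : F * w = 0 by rewrite /w mulrnAr mulrC -subrX1.
have Nw m : (\sum_(i < p * m) v ^+ i) * w = 0.
  elim: m => [|m IHm]; first by rewrite muln0 big_ord0 mul0r.
  rewrite mulnSr big_split_ord /= mulrDl IHm add0r.
  under eq_bigr do rewrite exprD.
  by rewrite -mulr_sumr -mulrA Fw mulr0.
have n_odd : odd (p ^ e.+1).
  by rewrite oddX /=; case: (even_prime pp) p3 => [->|].
have vn : v ^+ (p ^ e.+1) = 1 by rewrite expnSr exprM ve expr1n.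
have [b [k [k0 ub bw]]] := Bass_unit n_odd vn.
have {}bw : b * w = (1 + v) ^+ k * w by apply: bw; rewrite expnS Nw.
have bmw m : b ^+ m * w = (1 + v) ^+ (k * m) * w.
  elim: m => [|m IHm]; first by rewrite muln0.
  by rewrite exprSr -mulrA bw mulrCA IHm mulrA -exprD mulnS.
have kM0 : (0 < k * M)%N by rewrite muln_gt0 k0.
have := bmw M; rewrite UM // mul1r => wE.
pose ev (q : {poly int}) : A := (map_poly intr q).[v].
have evf : ev ((1 + 'X) ^+ (k * M) - 1) = (1 + v) ^+ (k * M) - 1.
  by rewrite /ev rmorphB rmorphXn rmorphD /= rmorph1 map_polyX !hornerE.
have evg : ev (\sum_(i < p) 'X^i) = F.
  rewrite /ev rmorph_sum horner_sum; apply: eq_bigr => i _.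
  by rewrite /= map_polyXn hornerXn.
have evD x y : ev (x + y) = ev x + ev y by rewrite /ev rmorphD hornerD.
have evM x y : ev (x * y) = ev x * ev y by rewrite /ev rmorphM hornerM.
have evC x : ev x%:P = x%:~R by rewrite /ev map_polyC hornerC.
have [u [u' [m [m0 /(congr1 ev)]]]] := int_Bezout_cyclotomic pp p3 kM0.
rewrite evD !evM evf evg evC => /(congr1 (fun x => x * w)).
rewrite mulrDl -!mulrA Fw mulr0 addr0 mulrBl -wE mul1r subrr mulr0 => /esym mw.
exists `|m|%N; first by rewrite absz_gt0.
rewrite mulrnA -/w; case: m {m0} mw => n mw.
  by rewrite -mulr_natl.
apply/eqP; rewrite -mulr_natl -oppr_eq0 -mulNr; apply/eqP.
by rewrite -mw NegzE rmorphN.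
Qed.

End Bass.

(** * Finite reduced rings without unit *)

Lemma mulrn_coprime_eq0 (V : zmodType) (z : V) (p r : nat) :
  coprime p r -> (z *+ p = 0 -> z *+ r = 0 -> z = 0)%R.
Proof.
move=> co zp zr; have [p0|p0] := posnP p.
  by move: co zr; rewrite p0 /coprime gcd0n => /eqP ->.
have [km kn Ek _] := egcdnP r p0.
move: co Ek; rewrite /coprime => /eqP -> Ek.
have := congr1 (fun n => z *+ n)%R Ek.
by rewrite /= mulrnDr (mulnC km) (mulnC kn) !mulrnA zp zr !mul0rn add0r.
Qed.

Section QuasiRegular.
Local Open Scope ring_scope.
Variable A : comUnitRingType.
Implicit Types (s : seq A) (x y e f : A).

Definition mul_closed s := forall x y, x \in s -> y \in s -> x * y \in s.

(** These are the quasi-regular elements.  For a subring without unit s, those in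
    s correspond to the units congruent to 1 modulo s, which makes it possible to
    count the units of the factors of s inside A. *)
Definition qreg : pred A := fun x => (1 + x) \is a GRing.unit.

(** If x ^ i = x ^ (i + d) with d > 0, then the powers of x have period d from
    i on, and x ^ m = x ^ (2 m) for each positive multiple m >= i of d. *)
Lemma idempotent_power s x : reduced_ring A -> mul_closed s ->
  x \in s -> x != 0 ->
  exists m, let f := x ^+ m.+1 in [/\ f \in s, f * f = f & f != 0].
Proof.
move=> redA sM xs x0.
have xXs m : x ^+ m.+1 \in s.
  by elim: m => [|m IHm]; rewrite ?expr1 // exprS sM.
have /(uniqPn 0)[i [j [ltij]]] : ~~ uniq (mkseq (fun i => x ^+ i.+1) (size s).+1).
  apply/negP => uq.
  have sub : {subset mkseq (fun i => x ^+ i.+1) (size s).+1 <= s}.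
    by move=> y /mapP[m _ ->].
  by have := uniq_leq_size uq sub; rewrite size_mkseq ltnn.
rewrite size_mkseq => ltj; rewrite !nth_mkseq //; last exact: ltn_trans ltj.
move=> Eij; pose d := (j - i)%N.
have Ed m : (i < m)%N -> x ^+ (m + d) = x ^+ m.
  move=> ltim; rewrite (_ : m + d = j.+1 + (m - i.+1))%N; last by rewrite /d; lia.
  by rewrite exprD -Eij -exprD; congr (_ ^+ _); lia.
have Edk m k : (i < m)%N -> x ^+ (m + k * d) = x ^+ m.
  move=> ltim; elim: k => [|k IHk]; first by rewrite addn0.
  by rewrite mulSn (addnC d) addnA Ed // (leq_trans ltim) // leq_addr.
have d0 : (0 < d)%N by rewrite subn_gt0.
have [m Em] : exists m, (i.+1 * d = m.+1)%N by exists (i.+1 * d).-1; rewrite prednK // muln_gt0.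
exists m; split; first exact: xXs.
  by rewrite -exprD -{2}Em Edk //; nia.
by apply: contraNneq x0 => /redA ->.
Qed.

(** When e is the only nonzero idempotent of s and acts on s as the identity, s is
    a field with unit e, by idempotent_power. *)
Section FieldCase.
Variables (s : seq A) (e : A).
Hypotheses (redA : reduced_ring A) (us : uniq s) (s0 : 0 \in s).
Hypotheses (sB : sub_closed s) (sM : mul_closed s).
Hypotheses (es : e \in s) (ee : e * e = e) (e0 : e != 0).
Hypothesis idem : forall f y, f \in s -> f * f = f -> f != 0 -> y \in s -> f * y = y.

Let field_inv y : y \in s -> y != 0 -> exists2 y', y' \in s & y * y' = e.
Proof.
move=> ys y0; have [m [fs ff f0]] := idempotent_power redA sM ys y0.
exists (y ^+ m * e).
  by elim: m {fs ff f0} => [|m IHm]; rewrite ?mul1r // exprS -mulrA sM.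
by rewrite mulrA -exprS idem.
Qed.

(** 1 + x = (1 - e) + (e + x), and e + x is invertible in the field s unless it
    vanishes. *)
Lemma qreg_field x : x \in s -> qreg x = (x != - e).
Proof.
move=> xs; apply/idP/idP.
  move=> ux; apply: contraNneq e0 => Ex; move: ux; rewrite /qreg Ex => ux.
  by rewrite -(mulrI_eq0 _ (mulrI ux)) mulrBl mul1r ee subrr.
rewrite -addr_eq0 addrC => y0; set y := e + x in y0.
have ys : y \in s by apply: mem_addr.
have [y' y's yy'] := field_inv ys y0.
have ey := idem es ee e0 ys; have ey' := idem es ee e0 y's.
apply/unitrPr; exists (1 - e + y').
have -> : 1 + x = 1 - e + y by rewrite /y; ring.
have -> : (1 - e + y) * (1 - e + y') =
  1 - e - (e - e * e) + (y - e * y) + (y' - e * y') + y * y' by ring.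
by rewrite ee ey ey' yy' !subrr; ring.
Qed.

Lemma count_qreg_field : count qreg s = (size s).-1.
Proof.
rewrite (eq_in_count qreg_field) -(count_predC (pred1 (- e)) s).
by rewrite count_uniq_mem // mem_oppr.
Qed.

(** By Cauchy, some nonzero x has p x = 0 for a prime p; multiplying by the inverse of
    x, p kills e and then all of s, so no other prime divides the order. *)
Lemma size_field_prime_power : prime_power (size s).
Proof.
have s1 : (1 < size s)%N.
  apply: (uniq_leq_size (s1 := [:: 0; e])).
    by rewrite /= inE eq_sym e0.
  by move=> y; rewrite !inE => /orP[]/eqP ->.
have pp := pdiv_prime s1; set p := pdiv _ in pp.
have [x [xs x0 xp]] := additive_Cauchy s0 sB us pp (pdiv_dvd _).
have [x' x's xx'] := field_inv xs x0.
have ep : e *+ p = 0 by rewrite -xx' -mulrnAl xp mul0r.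
have yp y : y \in s -> y *+ p = 0.
  by move=> ys; rewrite -(idem es ee e0 ys) -mulrnAl ep mul0r.
have : p.-nat (size s).
  apply/pnatP => [|r pr rs]; first exact: ltnW.
  have [z [zs z0 zr]] := additive_Cauchy s0 sB us pr rs.
  apply: contraNT z0 => rp; apply/eqP/(mulrn_coprime_eq0 _ (yp z zs) zr).
  by rewrite prime_coprime // dvdn_prime2 // eq_sym.
move=> /p_natP[k Ek]; exists p, k; split=> //.
by case: k Ek => // Ek; rewrite Ek in s1.
Qed.

End FieldCase.

(** Peirce decomposition: s is the direct sum of its images under x |-> f x and
    x |-> x - f x, and (1 + a) (1 + b) = 1 + (a + b) for a and b in the two
    summands, whose product is 0. *)
Lemma count_qreg_split s f : uniq s -> 0 \in s -> sub_closed s -> mul_closed s ->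
  f \in s -> f * f = f ->
  let s1 := undup [seq f * x | x <- s] in
  let s2 := undup [seq x - f * x | x <- s] in
  count qreg s = (count qreg s1 * count qreg s2)%N.
Proof.
move=> us s0 sB sM fs ff s1 s2.
have in1 a : a \in s1 -> a \in s /\ f * a = a.
  by rewrite mem_undup => /mapP[x xs ->]; rewrite mulrA ff sM.
have in2 a : a \in s2 -> a \in s /\ f * a = 0.
  rewrite mem_undup => /mapP[x xs ->]; rewrite mulrBr mulrA ff subrr.
  by split=> //; apply: sB => //; apply: sM.
have qregM a b : f * a = a -> f * b = 0 -> qreg (a + b) = qreg a && qreg b.
  move=> fa fb; rewrite /qreg -unitrM; congr (_ \is a _).
  by rewrite (_ : (1 + a) * (1 + b) = 1 + (a + b) + a * b); last ring;
     rewrite -fa -mulrA (mulrC a) mulrA fb mul0r addr0.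
rewrite -!size_filter.
have -> : (size (seq.filter qreg s1) * size (seq.filter qreg s2))%N =
    size [seq a + b | a <- seq.filter qreg s1, b <- seq.filter qreg s2].
  by rewrite size_allpairs.
apply/perm_size/uniq_perm; first exact: filter_uniq.
  apply: allpairs_uniq; rewrite ?filter_uniq ?undup_uniq //.
  have fE u : u \in [seq (a, b) | a <- seq.filter qreg s1, b <- seq.filter qreg s2] ->
      f * (u.1 + u.2) = u.1.
    move=> /allpairsP[[a b] /= [+ + ->]] /=; rewrite !mem_filter.
    by move=> /andP[_ /in1[_ fa]] /andP[_ /in2[_ fb]]; rewrite mulrDr fa fb addr0.
  move=> [a b] [a' b'] /fE /= fu /fE /= fu' Euu'.
  have Ea : a = a' by rewrite -fu -fu' Euu'.
  by move: Euu'; rewrite Ea => /addrI ->.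
move=> x; rewrite mem_filter; apply/andP/allpairsP.
  move=> [qx xs]; exists (f * x, x - f * x) => /=.
  have E : x = f * x + (x - f * x) by rewrite addrC subrK.
  move: qx; rewrite {1}E qregM; last by rewrite mulrBr mulrA ff subrr.
    move=> /andP[qa qb]; split=> //.
      by rewrite mem_filter qa mem_undup map_f.
    by rewrite mem_filter qb mem_undup; apply/mapP; exists x.
  by rewrite mulrA ff.
move=> [[a b] /= [+ + ->]]; rewrite !mem_filter => /andP[qa /in1[as_ fa]] /andP[qb /in2[bs fb]].
by rewrite qregM // qa qb mem_addr.
Qed.

(** Used for the two Peirce projections; the last clause gives the decrease in the
    induction on the size of s. *)
Lemma image_subring s (h : A -> A) : uniq s -> 0 \in s -> sub_closed s -> mul_closed s ->
  {in s &, forall x y, h x - h y = h (x - y)} ->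
  {in s &, forall x y, h x * h y = h (x * y)} ->
  {in s, forall x, h x \in s} ->
  let t := undup [seq h x | x <- s] in
  [/\ 0 \in t, sub_closed t, mul_closed t &
      (exists2 y, y \in s & y \notin t) -> (size t < size s)%N].
Proof.
move=> us s0 sB sM hB hM hs t.
have inT z : z \in t -> exists2 x, x \in s & z = h x.
  by rewrite mem_undup => /mapP[x xs ->]; exists x.
have Tin x : x \in s -> h x \in t by move=> xs; rewrite mem_undup map_f.
split.
- by rewrite (_ : 0 = h 0) ?Tin // -[in RHS](subr0 0) -hB ?subrr.
- by move=> _ _ /inT[x xs ->] /inT[y ys ->]; rewrite hB ?Tin ?sB.
- by move=> _ _ /inT[x xs ->] /inT[y ys ->]; rewrite hM ?Tin ?sM.
move=> [y ys yt]; rewrite -[(size t).+1]/(size (y :: t)); apply: uniq_leq_size.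
  by rewrite /= yt undup_uniq.
by move=> z; rewrite inE => /orP[/eqP ->|/inT[x xs ->]] //; apply: hs.
Qed.

(** Split along an idempotent that does not act as the identity as long as there
    is one; what remains is zero or a field. *)
Lemma count_qreg_shifted_product s : reduced_ring A -> uniq s -> 0 \in s ->
  sub_closed s -> mul_closed s -> shifted_product (count qreg s).
Proof.
move=> redA; have [n] := ubnP (size s); elim: n s => // n IHn s les us s0 sB sM.
have [[f [y [fs ff f0 ys fy]]]|noidem] :=
    pselect (exists f y, [/\ f \in s, f * f = f, f != 0, y \in s & f * y != y]).
  rewrite (count_qreg_split us s0 sB sM fs ff).
  have [|||t0 tB tM tlt] := @image_subring s (fun x => f * x) us s0 sB sM.
  - by move=> x z _ _; rewrite mulrBr.
  - by move=> x z _ _; rewrite mulrACA ff.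
  - by move=> x xs; apply: sM.
  have [|||t'0 t'B t'M t'lt] := @image_subring s (fun x => x - f * x) us s0 sB sM.
  - by move=> x z _ _; ring.
  - move=> x z _ _.
    have -> : (x - f * x) * (z - f * z) = x * z - 2 * f * x * z + (f * f) * (x * z).
      by ring.
    by rewrite ff; ring.
  - by move=> x xs; apply: sB => //; apply: sM.
  apply: shifted_productM; apply: IHn; rewrite ?undup_uniq //.
    apply: leq_trans (_ : size s <= n)%N; last by rewrite -ltnS.
    apply: tlt; exists y => //; rewrite mem_undup; apply/mapP => -[x _ Ey].
    by move: fy; rewrite Ey mulrA ff eqxx.
  apply: leq_trans (_ : size s <= n)%N; last by rewrite -ltnS.
  apply: t'lt; exists f => //; rewrite mem_undup; apply/mapP => -[x _ Ef].
  by move: f0; rewrite -ff {2}Ef mulrBr mulrA ff subrr eqxx.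
(* No nontrivial splitting is left: s is zero or a field. *)
have idem f y : f \in s -> f * f = f -> f != 0 -> y \in s -> f * y = y.
  move=> fs ff f0 ys; apply/eqP/negPn/negP => fy.
  by apply: noidem; exists f, y.
have [/hasP[x xs x0]|/hasPn all0] := boolP (has (fun x => x != 0) s); last first.
  have -> : s = [:: 0].
    apply/perm_small_eq => //; apply: uniq_perm => // x; rewrite inE.
    by apply/idP/eqP => [/all0|-> //]; rewrite negbK => /eqP.
  exists [::] => //; rewrite big_nil /= /qreg addr0 unitr1.
  by [].
have [m [es ee e0]] := idempotent_power redA sM xs x0.
rewrite (count_qreg_field redA us s0 sB sM es ee e0 idem).
exists [:: size s]; last by rewrite big_seq1.
move=> q; rewrite inE => /eqP ->.
exact: (size_field_prime_power redA us s0 sB sM es ee e0 idem).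
Qed.

End QuasiRegular.

(** * The order of the unit group of a reduced ring *)

Section Assembly.
Local Open Scope ring_scope.

Lemma torsion_bound (V : zmodType) (s : seq V) :
  exists2 c, (0 < c)%N &
    forall x m, x \in s -> (0 < m)%N -> x *+ m = 0 -> x *+ c = 0.
Proof.
elim: s => [|y s [c c0 IHs]]; first by exists 1%N.
have [[m [m0 ym]]|nt] := pselect (exists m, (0 < m)%N /\ y *+ m = 0).
  exists (m * c)%N; first by rewrite muln_gt0 m0.
  move=> x k; rewrite inE => /orP[/eqP -> _ _|xs k0 xk].
    by rewrite mulrnA ym mul0rn.
  by rewrite mulnC mulrnA (IHs x k) // mul0rn.
exists c => // x k; rewrite inE => /orP[/eqP -> k0 yk|]; last exact: IHs.
by case: nt; exists k.
Qed.

Variable A : comUnitRingType.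

(** The additive span of ws is a quotient of (Z / c) ^ (size ws), and it is closed
    under product because the products of generators lie in it. *)
Lemma finite_subring_span (ws : seq A) (c : nat) : (0 < c)%N ->
  (forall w, w \in ws -> w *+ c = 0) ->
  (forall w w', w \in ws -> w' \in ws ->
     exists2 w'', w'' \in ws & w * w' = w'' - w - w') ->
  exists s, [/\ uniq s, 0 \in s, sub_closed s, mul_closed s &
    {subset ws <= s} /\ forall x, x \in s -> x *+ c = 0].
Proof.
move=> c0 wc wM.
pose comb x := exists a : nat -> nat, x = \sum_(i < size ws) ws`_i *+ a i.
have wc' (i : 'I_(size ws)) : ws`_i *+ c = 0 by rewrite wc ?mem_nth.
have combc x : comb x -> x *+ c = 0.
  move=> [a ->]; rewrite -sumrMnl big1 // => i _.
  by rewrite -mulrnA mulnC mulrnA wc' mul0rn.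
have comb0 : comb 0.
  by exists (fun => 0%N); rewrite big1.
have combD x y : comb x -> comb y -> comb (x + y).
  move=> [a ->] [b ->]; exists (fun i => a i + b i)%N.
  by rewrite -big_split; apply: eq_bigr => i _; rewrite mulrnDr.
have combMn x n : comb x -> comb (x *+ n).
  move=> cx; elim: n => [|n IHn]; first by rewrite mulr0n.
  by rewrite mulrS; apply: combD.
have combN x : comb x -> comb (- x).
  move=> cx; suff -> : - x = x *+ c.-1 by apply: combMn.
  by apply: (addrI x); rewrite subrr -mulrS prednK // combc.
have combw w : w \in ws -> comb w.
  move=> wws; exists (fun i => (i == index w ws) : nat).
  have lti : (index w ws < size ws)%N by rewrite index_mem.
  rewrite (bigD1 (Ordinal lti)) //= eqxx nth_index // big1 ?addr0 // => i ni.
  by rewrite (_ : (_ == _ :> nat) = false) //; apply: negbTE.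
have comb_sum (n : nat) (F : 'I_n -> A) : (forall i, comb (F i)) -> comb (\sum_i F i).
  by move=> HF; apply: big_ind.
have combM x y : comb x -> comb y -> comb (x * y).
  move=> [a ->] [b ->]; rewrite mulr_suml; apply/comb_sum => i.
  rewrite mulr_sumr; apply/comb_sum => j.
  rewrite mulrnAl mulrnAr; do 2!apply/combMn.
  have [w'' w''s ->] := wM _ _ (mem_nth 0 (ltn_ord i)) (mem_nth 0 (ltn_ord j)).
  apply/combD; last exact/combN/combw/mem_nth.
  by apply/combD; [apply: combw | apply/combN/combw/mem_nth].
case: c c0 wc wc' combc combN => // c _ wc wc' combc combN.
pose s := undup [seq \sum_(i < size ws) ws`_i *+ f i |
                 f : {ffun 'I_(size ws) -> 'I_c.+1}].
have sP x : x \in s <-> comb x.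
  rewrite mem_undup; split.
    move=> /codomP[f ->]; exists (fun i => if insub i is Some j then f j : nat else 0%N).
    by apply: eq_bigr => i _; rewrite valK.
  move=> [a ->]; apply/codomP; exists [ffun i : 'I_(size ws) => inord (a i %% c.+1)].
  apply: eq_bigr => i _; rewrite ffunE inordK ?ltn_mod //.
  rewrite {1}(divn_eq (a i) c.+1) mulrnDr mulnC mulrnA wc' mul0rn.
  by rewrite add0r.
exists s; split; first exact: undup_uniq.
- exact/sP.
- by move=> x y /sP cx /sP cy; apply/sP/combD => //; apply: combN.
- by move=> x y /sP cx /sP cy; apply/sP/combM.
by split=> [w /combw/sP | x /sP/combc].
Qed.

(** Lagrange's theorem for the subgroup H of the units u with u - 1 torsion. *)
Lemma unit_card_shifted_product (U : seq A) : reduced_ring A -> uniq U ->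
  (forall u, (u \in U) = (u \is a GRing.unit)) -> shifted_product (size U).
Proof.
move=> redA uU UP.
have [c c0 cP] := torsion_bound [seq u - 1 | u <- U].
pose H : pred A := fun u => (u - 1) *+ c == 0.
have UH u m : u \in U -> (0 < m)%N -> (u - 1) *+ m = 0 -> H u.
  by move=> uin m0 um; apply/eqP; apply: cP um => //; apply: map_f.
have H1 : H 1 by rewrite /H subrr mul0rn.
have HM x y : H x -> H y -> H (x * y).
  move=> /eqP Hx /eqP Hy; rewrite /H.
  have -> : x * y - 1 = x * (y - 1) + (x - 1) by ring.
  by rewrite mulrnDl Hx addr0 -mulrnAr Hy mulr0.
have HX x n : H x -> H (x ^+ n).
  by move=> Hx; elim: n => [|n IHn] //; rewrite exprS HM.
have U0 : (0 < size U)%N by case: (U) (unit_seq1 UP).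
have HP p u : prime p -> (3 < p)%N -> u \in U -> H (u ^+ p) -> H u.
  move=> pp p3 uin Hup; pose e := logn p (size U); pose r := ((size U)`_p^')%N.
  have Er : (size U = p ^ e * r)%N by rewrite -p_part partnC.
  (* Up to a power v is the p-part of u, and torsion_descent applies to it. *)
  pose v := u ^+ r.
  have vU : v \in U by rewrite UP unitrX // -UP.
  have ve : v ^+ (p ^ e) = 1 by rewrite -exprM mulnC -Er (unit_seq_expr UP uU uin).
  have vp : (v ^+ p - 1) *+ c = 0.
    by apply/eqP; rewrite -exprM mulnC exprM; apply: HX.
  have [|m m0 vm] := torsion_descent pp p3 U0 _ ve vp.
    by move=> x; rewrite -UP => xU; apply: (unit_seq_expr UP uU xU).
  have Hv : H v by apply: UH vm => //; rewrite muln_gt0 c0.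
  have cop : coprime p r.
    by have := coprime_partC p p (size U); rewrite part_pnat_id ?pnat_id.
  (* u is the quotient of a power of u ^ p by a power of v. *)
  have [km kn Ek _] := egcdnP r (prime_gt0 pp).
  move: Ek; rewrite (eqP cop) => Ek.
  have h1 : H (u ^+ (kn * r + 1)) by rewrite -Ek mulnC exprM; apply: HX.
  have h2 : H (u ^+ (kn * r)) by rewrite mulnC exprM; apply: HX.
  rewrite /H (_ : u - 1 = (u ^+ (kn * r + 1) - 1) - u * (u ^+ (kn * r) - 1)).
    by rewrite mulrnBl -mulrnAr (eqP h1) (eqP h2) mulr0 subr0.
  by rewrite addn1 exprS; ring.
have [m Em m3] := index_primes_le UP uU H1 HM HP.
rewrite Em; apply: shifted_productM; last first.
  by apply: shifted_product_3smooth => //; move: U0; rewrite Em muln_gt0 => /andP[].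
pose ws := [seq u - 1 | u <- seq.filter H U].
have [||s [us s0 sB sM [wss sc]]] := @finite_subring_span ws c c0.
- by move=> w /mapP[u]; rewrite mem_filter => /andP[/eqP Hu _] ->.
- move=> _ _ /mapP[u + ->] /mapP[v + ->]; rewrite !mem_filter => /andP[Hu uin] /andP[Hv vin].
  exists (u * v - 1); last by ring.
  by apply: map_f; rewrite mem_filter HM // (unit_seqM UP).
suff -> : count H U = count (@qreg A) s by apply: count_qreg_shifted_product.
rewrite -size_filter -(size_map (fun u => u - 1)) -size_filter.
apply/perm_size/uniq_perm; rewrite ?filter_uniq //.
  by rewrite map_inj_uniq ?filter_uniq //; apply: addIr.
move=> x; rewrite mem_filter; apply/mapP/andP.
  move=> [u]; rewrite mem_filter => /andP[Hu uin] ->.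
  rewrite /qreg addrC subrK -UP; split=> //; apply: wss.
  by apply: map_f; rewrite mem_filter Hu.
move=> [qx xs]; exists (1 + x); last by rewrite addrC addKr.
by rewrite mem_filter UP [X in _ && X]qx andbT /H addrC addKr sc.
Qed.

End Assembly.

(** * The density *)

Lemma reduced_unit_cards_shifted_product n : reduced_unit_cards n -> shifted_product n.
Proof.
move=> [A [redA finU <-]]; apply: unit_card_shifted_product redA (finmap.fset_uniq _) _ => u.
by rewrite in_fset_set //; apply/idP/idP; rewrite inE.
Qed.

Lemma density0_of_count (R : realType) (X : set nat) (P : pred nat) :
  (forall n, X n -> P n) ->
  (forall m, 0 < m -> exists n0, forall n, n0 <= n ->
     m * count P (iota 1 n) <= n) ->
  has_density X (0%R : R).
Proof.
move=> XP small; apply/cvgrPdist_lt => eps eps0.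
have [m m0 lt_m] : exists2 m, 0 < m & ((m%:R^-1 : R) < eps)%R.
  exists (Num.trunc eps^-1).+1 => //.
  rewrite invf_plt ?posrE ?ltr0n //; exact: truncnS_gt.
have [n0 Hn0] := small m m0.
exists n0.+1 => //= n /= lt_n; have := Hn0 n (ltnW lt_n).
have n_gt0 : 0 < n by apply: leq_ltn_trans lt_n.
rewrite -(ler_nat R) natrM sub0r normrN => le_n.
rewrite ger0_norm ?divr_ge0 ?ler0n //; apply: le_lt_trans lt_m.
rewrite ler_pdivrMr ?ltr0n // ler_pdivlMl ?ltr0n //.
apply: le_trans le_n; rewrite ler_wpM2l ?ler0n // ler_nat -size_filter.
apply: uniq_leq_size (finmap.fset_uniq _) _ => k.
have fin : finite_set (initial_part X n).
  by apply: (@sub_finite_set _ _ `I_n.+1) => // i [_ /andP[_]].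
rewrite in_fset_set // inE => -[/XP Pk k_n].
by rewrite mem_filter Pk mem_iota add1n ltnS.
Qed.

Theorem propositionA3 (R : realType) :
  has_density reduced_unit_cards (0%R : R).
Proof.
apply: (@density0_of_count _ _ (fun n => `[< shifted_product n >])).
  by move=> n /reduced_unit_cards_shifted_product/asboolP.
exact: shifted_product_count_small.
Qed.
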